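(* Let $X$ be a Hausdorff space with at least two points. The following statements are equivalent. (1) $\mathscr{F}[X]$ is OHD. (2) $\mathscr{F}[X]$ is UC. (3) $\mathscr{F}[X]$ is $\pi$-UC. (4) $X$ is UC.
   Context: The Pixley-Roy hyperspace $\mathscr{F}[X]$ is the set of all non-empty finite subsets of $X$ with the topology having as a base all sets $[F,U]=\{G\in\mathscr{F}[X] : F\subseteq G\subseteq U\}$, where $F\in\mathscr{F}[X]$ and $U\subseteq X$ is open. Let $Y$ be a topological space. - A sequence $(U_n)_{n\in\omega}$ of non-empty open sets converges to $y\in Y$ if for every open $U\ni y$ there is $m\in\omega$ with $U_n\subseteq U$ for all $n\geq m$. $Y$ is OHD if no sequence of non-empty open subsets of $Y$ converges to a point of $Y$. - A local $\pi$-basis for $y\in Y$ is a family $\mathscr{B}$ of non-empty open sets such that every open $U\ni y$ contains some $B\in\mathscr{B}$; it is a local base if moreover $y\in\bigcap\mathscr{B}$. $\chi(y,Y)$ (resp. $\pi\chi(y,Y)$) is the least cardinality of a local base (resp. local $\pi$-basis) for $y$ in $Y$. $Y$ is UC (resp. $\pi$-UC) if $\chi(y,Y)>\omega$ (resp. $\pi\chi(y,Y)>\omega$) for every $y\in Y$. *)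

(* Defs.v *)
From HB Require Import structures.
From mathcomp Require Import all_boot all_order.
From mathcomp Require Import all_classical.
From mathcomp Require Import topology.

Set Implicit Arguments.
Unset Strict Implicit.
Unset Printing Implicit Defensive.

Local Open Scope classical_set_scope.
Local Open Scope card_scope.

(* A cardinal is represented by a set of that cardinality: [least_card F] is
   a member of the family [F] of minimal cardinality. By [least_cardP] the
   default value [set0] is only used when [F] is empty. *)
Definition least_card (T : Type) (F : set (set T)) : set T :=
  xget set0 [set A | F A /\ forall B, F B -> A #<= B].

(* Zorn's lemma, applied to sets of choice functions for [F] that pairwise
   differ on every member of [F]. *)
Lemma ex_least_card (T : Type) (F : set (set T)) :
  F !=set0 -> exists A, F A /\ forall B, F B -> A #<= B.
Proof.
move=> [A0 FA0].
pose P (Z : set (set T -> T)) := (forall f B, Z f -> F B -> B (f B)) /\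
  (forall f g B, Z f -> Z g -> F B -> f B = g B -> f = g).
have [Z [[Zch Zinj] Zmax]] : exists Z, P Z /\ forall Z', Z `<` Z' -> ~ P Z'.
  apply: Zorn_bigcup => C CP Ctot; split.
    by move=> f B [Z CZ Zf]; apply: (CP _ CZ).1.
  move=> f g B [Z CZ Zf] [Z' CZ' Zg].
  have [ZZ'|Z'Z] := Ctot _ _ CZ CZ'.
    by apply: (CP _ CZ').2 => //; apply: ZZ'.
  by apply: (CP _ CZ).2 => //; apply: Z'Z.
have [[B [FB Bsurj]]|nsurj] :=
    pselect (exists B, F B /\ forall t, B t -> exists2 f, Z f & f B = t).
  exists B; split=> // B' FB'.
  have [->|/set0P[t0 /Bsurj[f0 _ _]]] := eqVneq B set0.
    exact: card_ge0.
  have /choice [s sP] : forall t, exists f, B t -> Z f /\ f B = t.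
    move=> t; have [/Bsurj[f Zf fB]|nBt] := pselect (B t); first by exists f.
    by exists f0.
  suff [f] : $|{injfun B >-> B'}| by exact: inj_card_le.
  apply/injfunPex; exists (fun t => s t B').
    by move=> t Bt /=; exact: Zch (sP t Bt).1 FB'.
  move=> t u /set_mem Bt /set_mem Bu e.
  have [Zt <-] := sP t Bt; have [Zu <-] := sP u Bu.
  by rewrite (Zinj (s t) (s u) B').
have miss B : F B -> exists t, B t /\ forall f, Z f -> f B <> t.
  move=> FB; apply: contrapT => nt; apply: nsurj; exists B; split=> // t Bt.
  apply: contrapT => nf; apply: nt; exists t; split=> // f Zf fB.
  by apply: nf; exists f.
have [t0 _] := miss _ FA0.
have /choice [h hP] : forall B, exists t, F B -> B t /\ forall f, Z f -> f B <> t.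
  by move=> B; have [/miss[t ?]|nFB] := pselect (F B); [exists t | exists t0].
exfalso; apply: (Zmax (Z `|` [set h])).
  split; first by left.
  move=> /(_ h (or_intror erefl)) Zh.
  exact: (hP _ FA0).2 Zh erefl.
split.
  by move=> f B [Zf|->] FB; [exact: Zch Zf FB | exact: (hP _ FB).1].
move=> f g B [Zf|->] [Zg|->] FB e //; first exact: Zinj Zf Zg FB e.
  by case: ((hP _ FB).2 _ Zf e).
by case: ((hP _ FB).2 _ Zg (esym e)).
Qed.

Lemma least_cardP (T : Type) (F : set (set T)) : F !=set0 ->
  F (least_card F) /\ forall B, F B -> least_card F #<= B.
Proof. by move=> /ex_least_card; exact: xgetPex. Qed.

Section CardinalFunctions.
Variable Y : topologicalType.
Implicit Types (y : Y) (B : set (set Y)).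

Definition seq_converges_to (U : nat -> set Y) y :=
  forall V, open V -> V y -> exists m, forall n, (m <= n)%N -> U n `<=` V.

Definition OHD := ~ exists (U : nat -> set Y) y,
  (forall n, open (U n) /\ U n !=set0) /\ seq_converges_to U y.

Definition local_pi_basis y B :=
  (forall V, B V -> open V /\ V !=set0) /\
  (forall U, open U -> U y -> exists2 V, B V & V `<=` U).

Definition local_base y B := local_pi_basis y B /\ (\bigcap_(V in B) V) y.

Definition character y : set (set Y) := least_card [set B | local_base y B].

Definition pi_character y : set (set Y) :=
  least_card [set B | local_pi_basis y B].

Lemma ex_local_base y : [set B | local_base y B] !=set0.
Proof.
exists [set V | open V /\ V y]; split=> [|V [] //].
split=> [V [oV Vy]|U oU Uy]; first by split=> //; exists y.
by exists U.
Qed.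

Lemma ex_local_pi_basis y : [set B | local_pi_basis y B] !=set0.
Proof. by have [B []] := ex_local_base y; exists B. Qed.

Definition UC := forall y, ~ countable (character y).

Definition pi_UC := forall y, ~ countable (pi_character y).

End CardinalFunctions.

Definition pixley_roy (X : topologicalType) : Type :=
  [set G : set X | finite_set G /\ G !=set0].

Section PixleyRoy.
Variable X : topologicalType.

HB.instance Definition _ := Choice.on (pixley_roy X).

(* The set [F, U], where [p = (F, U)]. *)
Definition pixley_roy_base (p : set X * set X) : set (pixley_roy X) :=
  [set G | p.1 `<=` val G /\ val G `<=` p.2].

Definition pixley_roy_index : set (set X * set X) :=
  [set p | [/\ finite_set p.1, p.1 !=set0 & open p.2]].

Lemma pixley_roy_base_cover :
  \bigcup_(p in pixley_roy_index) pixley_roy_base p = setT.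
Proof.
apply/seteqP; split=> // G _; have [fG G0] := set_mem (valP G).
by exists (val G, setT) => //; split=> //; exact: openT.
Qed.

Lemma pixley_roy_base_join p q G :
  pixley_roy_index p -> pixley_roy_index q ->
  pixley_roy_base p G -> pixley_roy_base q G ->
  exists r, [/\ pixley_roy_index r, pixley_roy_base r G &
    pixley_roy_base r `<=` pixley_roy_base p `&` pixley_roy_base q].
Proof.
move=> [_ _ op] [_ _ oq] [pG Gp] [qG Gq].
have [fG G0] := set_mem (valP G).
exists (val G, p.2 `&` q.2); split.
- by split=> //; exact: openI.
- by split=> // x Gx; split; [exact: Gp | exact: Gq].
- move=> H [/= GH Hpq]; split; split.
  + exact: subset_trans GH.
  + by move=> x /Hpq[].
  + exact: subset_trans GH.
  + by move=> x /Hpq[].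
Qed.

HB.instance Definition _ := isBaseTopological.Build (pixley_roy X)
  pixley_roy_base_cover pixley_roy_base_join.

End PixleyRoy.

(* Main.v *)
(* A neighbourhood base at the finite set [F] in [X] and one at the point [F]
   of the hyperspace are the same thing up to [U |-> [F, U]]. If basic sets
   [[F_n, U_n]] form a local pi-base at [F], those with [F `<=` F_n] already
   have their [U_n] forming a neighbourhood base at [F] in [X], so pi-bases and
   convergent sequences are as strong as local bases. Finally, in a Hausdorff
   space a neighbourhood base at [F] restricts to a local base at each
   [x] in [F], by intersecting with an open set that isolates [x] from
   [F `\ x]. *)

Require Import Defs.
From mathcomp Require Import all_boot all_order.
From mathcomp Require Import all_classical.
From mathcomp Require Import topology.

Set Implicit Arguments.
Unset Strict Implicit.
Unset Printing Implicit Defensive.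

Local Open Scope classical_set_scope.

Section CountableCharacter.
Variable Y : topologicalType.
Implicit Types (y : Y) (B : set (set Y)).

Lemma UC_local_base : UC Y <-> forall y B, local_base y B -> ~ countable B.
Proof.
split=> [ucY y B lB cB|nlB y]; last first.
  by apply: (nlB y); have [] := least_cardP (ex_local_base y).
apply: (ucY y); apply: sub_countable cB.
by have [_] := least_cardP (ex_local_base y); apply.
Qed.

Lemma pi_UC_local_pi_basis :
  pi_UC Y <-> forall y B, local_pi_basis y B -> ~ countable B.
Proof.
split=> [ucY y B lB cB|nlB y]; last first.
  by apply: (nlB y); have [] := least_cardP (ex_local_pi_basis y).
apply: (ucY y); apply: sub_countable cB.
by have [_] := least_cardP (ex_local_pi_basis y); apply.
Qed.

Lemma open_local_base y B : (forall V, B V -> open V /\ V y) ->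
  (forall U, open U -> U y -> exists2 V, B V & V `<=` U) -> local_base y B.
Proof.
move=> BoV BU; split=> [|V /BoV[]//].
by split=> // V /BoV[oV Vy]; split=> //; exists y.
Qed.

(** An enumeration of a countable local base at [y] becomes, after finite intersections, a
    decreasing sequence of open neighbourhoods converging to [y]. *)
Lemma OHD_UC : OHD Y -> UC Y.
Proof.
move=> ohdY; apply/UC_local_base => y B [[BoV BU] By] cB; apply: ohdY.
move: cB; rewrite /countable => /pfcard_geP[B0|[f]].
  by have [V] := BU _ openT I; rewrite B0.
have Bf n : B (f n) by exact: funS.
(* The bound [n.+1] keeps [f n] among the factors, so every term from index [m] on lies in [f m]. *)
exists (fun n => \big[setI/setT]_(i < n.+1) f i), y; split=> [n|U oU Uy].
  split; last by exists y; rewrite -bigcap_mkord => i _; apply: By; exact: Bf.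
  apply: big_ind => [||i _]; [exact: openT | exact: openI |].
  by have [] := BoV _ (Bf i).
have [V BV VU] := BU _ oU Uy; have [m _ fm] := @surj _ _ _ _ f V BV.
exists m => n mn x; rewrite -bigcap_mkord => /(_ m mn).
by rewrite fm; exact: VU.
Qed.

End CountableCharacter.

(** Induction on an enumeration of [F]: each new point shrinks the neighbourhood of [x] and enlarges
    that of [F]. *)
Lemma hausdorff_separate_finite (X : topologicalType) (x : X) (F : set X) :
  hausdorff_space X -> finite_set F -> ~ F x ->
  exists U V, [/\ open U, open V, U x, F `<=` V & U `&` V = set0].
Proof.
rewrite open_hausdorff => hausX /finite_seqP[s ->{F}].
elim: s => [_|z s IHs /=].
  by exists setT, set0; split=> //; [exact: openT | exact: open0 | exact: setI0].
rewrite inE => /negP; rewrite negb_or => /andP[xz /negP/IHs[U [V]]].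
move=> [oU oV Ux sV UV0].
have [[A B] /= [/set_mem Ax /set_mem Bz] [oA oB /eqP AB0]] := hausX _ _ xz.
exists (U `&` A), (V `|` B); split=> //; [exact: openI | exact: openU | |].
  by move=> w /=; rewrite inE => /orP[/eqP->|/sV]; [right | left].
rewrite -subset0 => w [[Uw Aw] [Vw|Bw]].
  by rewrite -UV0.
by rewrite -AB0.
Qed.

Section PixleyRoyBase.
Variable X : topologicalType.
Implicit Types (G : pixley_roy X) (F U : set X) (p : set X * set X).

Lemma pixley_roy_finite G : finite_set (val G).
Proof. by have [] := set_mem (valP G). Qed.

Lemma pixley_roy_neq0 G : val G !=set0.
Proof. by have [] := set_mem (valP G). Qed.

Definition pixley_roy_of F (finF : finite_set F) (F0 : F !=set0) :
  pixley_roy X := SigSub (mem_set (conj finF F0)).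

Lemma open_pixley_roy_base p :
  pixley_roy_index p -> open (pixley_roy_base p).
Proof.
move=> ip; exists [set p] => [_ ->//|].
by rewrite bigcup_set1.
Qed.

Lemma open_pixley_roy_base_val G U :
  open U -> open (pixley_roy_base (val G, U)).
Proof.
move=> oU; apply: open_pixley_roy_base.
by split=> //; [exact: pixley_roy_finite | exact: pixley_roy_neq0].
Qed.

(** If [[F, U]] contains [G], then enlarging [F] to [G] only shrinks the basic set. *)
Lemma open_pixley_royP (W : set (pixley_roy X)) G : open W -> W G ->
  exists U, [/\ open U, val G `<=` U & pixley_roy_base (val G, U) `<=` W].
Proof.
move=> [D Didx <-] [p Dp [pG Gp]]; exists p.2.
have [_ _ op] := Didx _ Dp; split=> // H [/= GH Hp]; exists p => //.
by split=> //; exact: subset_trans GH.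
Qed.

(** Test the inclusion on [G] itself for the first claim, and on [G] with one point [x] of [U] added
    for the second. *)
Lemma sub_pixley_roy_base G U p : val G `<=` U ->
  pixley_roy_base (val G, U) `<=` pixley_roy_base p ->
  p.1 `<=` val G /\ U `<=` p.2.
Proof.
move=> GU sGU; split=> [|x Ux]; first by have [] := sGU G (conj (fun x => id) GU).
have finGx : finite_set (val G `|` [set x]).
  by rewrite finite_setU; split; [exact: pixley_roy_finite | exact: finite_set1].
have Gx0 : val G `|` [set x] !=set0 by exists x; right.
have [] := sGU (pixley_roy_of finGx Gx0); last by move=> _; apply; right.
by split=> [y|y [/GU//|->//]]; left.
Qed.

Lemma local_base_pixley_roy G (B : set (set X)) :
  (forall V, B V -> open V /\ val G `<=` V) ->
  (forall U, open U -> val G `<=` U -> exists2 V, B V & V `<=` U) ->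
  local_base G ((fun V => pixley_roy_base (val G, V)) @` B).
Proof.
move=> BoV BU; apply: open_local_base => [_ [V /BoV[oV GV] <-]|W oW WG].
  by split; [exact: open_pixley_roy_base_val | split].
have [U [oU GU UW]] := open_pixley_royP oW WG.
have [V BV VU] := BU _ oU GU; exists (pixley_roy_base (val G, V)).
  by exists V.
by apply: subset_trans UW => H [/= GH HV]; split=> //; exact: subset_trans VU.
Qed.

Lemma UC_pixley_roy_pi_UC : UC (pixley_roy X) -> pi_UC (pixley_roy X).
Proof.
move=> /UC_local_base ucFX; apply/pi_UC_local_pi_basis => G B [BoV BU] cB.
have /choice[h hP] : forall W, exists q : pixley_roy X * set X, B W ->
    [/\ open q.2, val q.1 `<=` q.2 & pixley_roy_base (val q.1, q.2) `<=` W].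
  move=> W; have [BW|nBW] := pselect (B W); last by exists (G, setT).
  have [oW [H WH]] := BoV _ BW.
  by have [U HU] := open_pixley_royP oW WH; exists (H, U).
(* The restriction makes every member of [C] contain [G]. It loses nothing: a basic set inside some
   [[G, U]] satisfies it automatically. *)
pose C := (snd \o h) @` [set W | B W /\ val G `<=` val (h W).1].
have cC : countable C.
  apply: (sub_countable (card_image_le _ _)).
  by apply: sub_countable cB; apply: subset_card_le => W [].
apply: (ucFX G) (sub_countable (card_image_le _ _) cC).
apply: local_base_pixley_roy => [_ [W [BW GhW] <-]|U oU GU].
  by have [oW sW _] := hP _ BW; split=> //; exact: subset_trans sW.
have [W BW sWU] := BU _ (open_pixley_roy_base_val G oU) (conj (fun x => id) GU).
have [_ sW sWW] := hP _ BW.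
have [GhW hWU] := sub_pixley_roy_base sW (subset_trans sWW sWU).
by exists (h W).2 => //; exists W.
Qed.

(** A countable local base at [x] would give one at the singleton of [x], since an open set contains
    that singleton exactly when it contains [x]. *)
Lemma pi_UC_pixley_roy_UC : pi_UC (pixley_roy X) -> UC X.
Proof.
move=> /pi_UC_local_pi_basis ucFX; apply/UC_local_base => x B [[BoV BU] Bx] cB.
have x0 : [set x] !=set0 by exists x.
pose G := pixley_roy_of (finite_set1 x) x0.
suff [lB _] : local_base G ((fun V => pixley_roy_base (val G, V)) @` B).
  by apply: ucFX lB (sub_countable (card_image_le _ _) cB).
apply: local_base_pixley_roy => [V BV|U oU GU].
  by have [oV _] := BoV _ BV; split=> // _ ->; exact: Bx.
by apply: BU => //; exact: GU.
Qed.

Lemma UC_pixley_roy_OHD : hausdorff_space X -> UC X -> OHD (pixley_roy X).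
Proof.
move=> hausX /UC_local_base ucX [W [G [Wo cvgW]]].
have /choice[h hP] : forall n, exists q : pixley_roy X * set X,
    [/\ open q.2, val q.1 `<=` q.2 & pixley_roy_base (val q.1, q.2) `<=` W n].
  move=> n; have [oW [H WH]] := Wo n.
  by have [U HU] := open_pixley_royP oW WH; exists (H, U).
(* Convergence is used only through one term lying inside [[G, U]]. *)
have hU U : open U -> val G `<=` U ->
    exists n, val G `<=` val (h n).1 /\ (h n).2 `<=` U.
  move=> oU GU.
  have [m mP] := cvgW _ (open_pixley_roy_base_val G oU) (conj (fun x => id) GU).
  have [_ sm smW] := hP m; exists m.
  exact: sub_pixley_roy_base sm (subset_trans smW (mP m (leqnn m))).
have [x Gx] := pixley_roy_neq0 G.
have [||A [A' [oA oA' Ax GA' AA'0]]] :=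
    @hausdorff_separate_finite X x (val G `\ x) hausX.
- exact: finite_setD (pixley_roy_finite G).
- by move=> [_]; apply.
pose N := [set n | val G `<=` val (h n).1].
apply: (ucX x ((fun n => (h n).2 `&` A) @` N)); last first.
  exact: sub_countable (card_image_le _ _) (countableP _).
apply: open_local_base => [_ [n Nn <-]|U oU Ux].
  have [oh sh _] := hP n; split; first exact: openI.
  by split=> //; apply/sh/Nn.
(* This neighbourhood of [G] constrains only the part near [x]: intersecting with [A] discards [A']
   and leaves a subset of [U]. *)
have [||n [Nn nU]] := hU ((U `&` A) `|` A').
- by apply: openU => //; exact: openI.
- move=> y Gy; have [->|yx] := pselect (y = x); first by left.
  by right; exact: GA'.
exists ((h n).2 `&` A); first by exists n.
move=> y [/nU[[]//|A'y] Ay].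
by have : (A `&` A') y by []; rewrite AA'0.
Qed.

End PixleyRoyBase.

Theorem theorem8 (X : topologicalType) (hausX : hausdorff_space X)
    (twoX : exists x y : X, x <> y) :
  [<-> OHD (pixley_roy X);
       UC (pixley_roy X);
       pi_UC (pixley_roy X);
       UC X].
Proof.
split; first exact: OHD_UC.
split; first exact: UC_pixley_roy_pi_UC.
split; first exact: pi_UC_pixley_roy_UC.
exact: UC_pixley_roy_OHD.
Qed.
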